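(* Let $X$ be a metrizable space. The following are equivalent: (a) $X$ is hemicompact; (b) either $X$ is compact, or there is a metrizable compact space $K$ such that $X$ is homeomorphic to $K\setminus\{p\}$, where $p$ is a non-isolated point of $K$; (c) $C_k(X)$ is metrizable; (d) $(C_k(X), w)$ is Eberlein-Grothendieck.
   Context: All topological spaces are assumed to be Tychonoff and all vector spaces are over $\mathbb{R}$. $C_k(X)$ (resp. $C_p(X)$) is the space $C(X)$ of continuous real-valued functions on $X$ with the compact-open topology (resp. the topology of pointwise convergence). For a locally convex space $E$, $(E,w)$ denotes $E$ with its weak topology $w=\sigma(E,E^{\ast})$, where $E^{\ast}$ is the space of continuous linear functionals on $E$. A topological space $Y$ is Eberlein-Grothendieck if there is a homeomorphic embedding of $Y$ into $C_p(K)$ for some compact space $K$. A space $X$ is hemicompact if there is a sequence $\{K_n : n\in\omega\}$ of compact subsets of $X$ such that every compact $K\subset X$ is contained in some $K_n$. *)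

(* Defs.v *)
From HB Require Import structures.
From mathcomp Require Import all_boot all_order all_algebra.
From mathcomp Require Import all_classical all_reals all_analysis.
From mathcomp Require Import ring.

Set Implicit Arguments.
Unset Strict Implicit.
Unset Printing Implicit Defensive.

Import Order.TTheory GRing.Theory Num.Theory.
Import numFieldNormedType.Exports.

Local Open Scope classical_set_scope.
Local Open Scope ring_scope.
Local Open Scope convex_scope.

Definition homeomorphic (T U : topologicalType) : Prop :=
  exists (f : T -> U) (g : U -> T),
    [/\ cancel f g, cancel g f, continuous f & continuous g].

(* [set_type S] carries the subspace topology. *)
Definition embeds_in (T U : topologicalType) : Prop :=
  exists S : set U, homeomorphic T (set_type S).

Definition metrizable (R : realType) (T : topologicalType) : Prop :=
  exists M : metricType R, homeomorphic T M.

Definition tychonoff_space (T : topologicalType) : Prop :=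
  completely_regular_space T /\ hausdorff_space T.

Definition hemicompact (T : topologicalType) : Prop :=
  exists K : nat -> set T, (forall n, compact (K n)) /\
    (forall C : set T, compact C -> exists n, C `<=` K n).

Definition Cp (R : realType) (X : topologicalType) : Type :=
  continuousType X R.

HB.instance Definition _ (R : realType) (X : topologicalType) :=
  Choice.copy (Cp R X) (continuousType X R).

HB.instance Definition _ (R : realType) (X : topologicalType) :=
  Topological.copy (Cp R X)
    (initial_topology (fun f : continuousType X R => (f : {ptws X -> R}))).

Definition eberlein_grothendieck (R : realType) (Y : topologicalType) : Prop :=
  exists K : topologicalType,
    [/\ tychonoff_space K, compact [set: K] & embeds_in Y (Cp R K)].

Definition Ck (R : realType) (X : topologicalType) : Type :=
  continuousType X R.

HB.instance Definition _ (R : realType) (X : topologicalType) :=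
  Choice.copy (Ck R X) (continuousType X R).

HB.instance Definition _ (R : realType) (X : topologicalType) :=
  Topological.copy (Ck R X)
    (initial_topology
      (fun f : continuousType X R => (f : {compact-open, X -> R}))).

Definition Ck_fun (R : realType) (X : topologicalType) (f : Ck R X) : X -> R :=
  (f : continuousType X R).

Section Ck_lmodule.
Context (R : realType) (X : topologicalType).
Implicit Types (f g : Ck R X) (a : R).

Lemma Ck_zero_continuous : continuous (fun _ : X => 0 : R).
Proof. by move=> x; exact: cvg_cst. Qed.

Lemma Ck_opp_continuous f : continuous (fun x => - Ck_fun f x).
Proof. by move=> x; apply: cvgN; exact: cts_fun. Qed.

Lemma Ck_add_continuous f g : continuous (fun x => Ck_fun f x + Ck_fun g x).
Proof. by move=> x; apply: cvgD; exact: cts_fun. Qed.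

Lemma Ck_scale_continuous a f : continuous (fun x => a * Ck_fun f x).
Proof. by move=> x; apply: cvgMr; exact: cts_fun. Qed.

Definition Ck_zero : Ck R X :=
  (mkcts Ck_zero_continuous : continuousType X R).
Definition Ck_opp f : Ck R X :=
  (mkcts (@Ck_opp_continuous f) : continuousType X R).
Definition Ck_add f g : Ck R X :=
  (mkcts (@Ck_add_continuous f g) : continuousType X R).
Definition Ck_scale a f : Ck R X :=
  (mkcts (@Ck_scale_continuous a f) : continuousType X R).

Fact Ck_addA : associative Ck_add.
Proof. by move=> f g h; apply/continuousEP => x; exact: addrA. Qed.
Fact Ck_addC : commutative Ck_add.
Proof. by move=> f g; apply/continuousEP => x; exact: addrC. Qed.
Fact Ck_add0 : left_id Ck_zero Ck_add.
Proof. by move=> f; apply/continuousEP => x; exact: add0r. Qed.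
Fact Ck_addN : left_inverse Ck_zero Ck_opp Ck_add.
Proof. by move=> f; apply/continuousEP => x; exact: addNr. Qed.

HB.instance Definition _ :=
  GRing.isZmodule.Build (Ck R X) Ck_addA Ck_addC Ck_add0 Ck_addN.

Fact Ck_scaleA a b f : Ck_scale a (Ck_scale b f) = Ck_scale (a * b) f.
Proof. by apply/continuousEP => x; exact: mulrA. Qed.
Fact Ck_scale1 : left_id 1 Ck_scale.
Proof. by move=> f; apply/continuousEP => x; exact: mul1r. Qed.
Fact Ck_scaleDr : right_distributive Ck_scale +%R.
Proof. by move=> a f g; apply/continuousEP => x; exact: mulrDr. Qed.
Fact Ck_scaleDl f : {morph Ck_scale^~ f : a b / a + b}.
Proof. by move=> a b; apply/continuousEP => x; exact: mulrDl. Qed.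

HB.instance Definition _ :=
  GRing.Zmodule_isLmodule.Build R (Ck R X)
    Ck_scaleA Ck_scale1 Ck_scaleDr Ck_scaleDl.

End Ck_lmodule.

Section Ck_tvs.
Context (R : realType) (X : topologicalType).
Implicit Types (f g : Ck R X).

Local Notation ev := (@Ck_fun R X).

Let ent_e (e : R) : 0 < e -> entourage [set xy : R * R | `|xy.1 - xy.2| < e].
Proof. by move=> e0; rewrite -entourage_ballE; exists e. Qed.

Lemma Ck_nbhsP f (A : set (Ck R X)) : nbhs f A <->
  exists K (e : R), [/\ compact K, 0 < e &
    forall g, (forall x, K x -> `|ev f x - ev g x| < e) -> A g].
Proof.
have cf : continuous (ev f) by exact: cts_fun.
split; last first.
  move=> [K [e [cK e0 KA]]].
  pose N := nbhs (ev f : {compact-open, X -> R}).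
  have H := (@compact_open_fam_compactP _ R _ N cf _).1 (fun A => id).
  have FN : Filter N by exact: (nbhs_filter (ev f : {compact-open, X -> R})).
  have := H FN _ (fam_nbhs (ev f) (ent_e e0) cK); rewrite /N.
  rewrite nbhsE => -[B [oB Bf] BA].
  exists (ev @^-1` B); split => //; first by exists B.
  by move=> g /= /BA /= Hg; apply: KA.
move=> [_ [[B oB <-] /= Bf BA]].
pose F : set_system (X -> R) := filter_from
  [set Ke : set X * R | compact Ke.1 /\ 0 < Ke.2]
  (fun Ke => [set g | forall x, Ke.1 x -> `|ev f x - g x| < Ke.2]).
have FF : Filter F.
  apply: filter_from_filter.
    by exists (set0, 1); split => //=; exact: compact0.
  move=> [K1 e1] [K2 e2] /= [cK1 e10] [cK2 e20].
  exists (K1 `|` K2, Num.min e1 e2) => /=.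
    by split; [exact: compactU|rewrite lt_min e10].
  move=> g /= H; split=> x Kx; (have /H : (K1 `|` K2) x by [left|right]);
    by rewrite lt_min => /andP[].
have : {compact-open, F --> (ev f)}.
  apply/compact_open_fam_compactP => //; apply/fam_cvgP => K cK.
  move=> U /uniform_nbhs [E [entE EU]]; apply: filterS EU _.
  move: entE; rewrite -entourage_ballE => -[e e0 eE].
  exists (K, e) => // g /= Hg x Kx; apply: eE; exact: Hg.
have nB : nbhs (ev f : {compact-open, X -> R}) B by apply: open_nbhs_nbhs.
move=> /(_ B nB) [[K e] /= [cK e0] KB].
by exists K, e; split => // g Hg; apply: BA; apply: KB.
Qed.

Lemma Ck_addr_continuous : continuous (fun fg : Ck R X * Ck R X => fg.1 + fg.2).
Proof.
move=> [f g] A /= /Ck_nbhsP[K [e [cK e0 KA]]].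
exists ([set h | forall x, K x -> `|ev f x - ev h x| < e / 2],
        [set h | forall x, K x -> `|ev g x - ev h x| < e / 2]) => /=.
  by split; apply/Ck_nbhsP; exists K, (e / 2); split; rewrite ?divr_gt0.
move=> [h k] /= [Hh Hk]; apply: KA => x Kx.
rewrite [X in `|X|](_ : _ = (ev f x - ev h x) + (ev g x - ev k x)).
  rewrite (splitr e) (le_lt_trans (ler_normD _ _))// ltrD//; first exact: Hh.
  exact: Hk.
by rewrite addrACA -opprD.
Qed.

Lemma Ck_scaler_continuous : continuous (fun z : R^o * Ck R X => z.1 *: z.2).
Proof.
move=> [a f] A /= /Ck_nbhsP[K [e [cK e0 KA]]].
have [M M0 fM] : exists2 M : R, 0 < M & forall x, K x -> `|ev f x| <= M.
  have : compact (ev f @` K).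
    by apply: continuous_compact => //; apply: continuous_subspaceT;
      exact: cts_fun.
  move=> /compact_bounded[M [_ HM]].
  exists (`|M| + 1) => [|x Kx]; first by rewrite ltr_wpDl.
  by apply: HM; [rewrite (le_lt_trans (ler_norm _))// ltrDl|exists x].
pose d := Num.min 1 (e / 2 / M).
have d0 : 0 < d by rewrite lt_min ltr01 !divr_gt0.
pose c := e / 2 / (`|a| + 1).
have a1 : 0 < `|a| + 1 by rewrite ltr_wpDl.
exists ([set b | `|a - b| < d],
        [set h | forall x, K x -> `|ev f x - ev h x| < c]) => /=.
  split; first by apply/nbhs_ballP; exists d.
  by apply/Ck_nbhsP; exists K, c; split; rewrite ?divr_gt0.
move=> [b h] /= [Hb Hh]; apply: KA => x Kx.
rewrite [X in `|X|](_ : _ =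
  (a - b) * ev f x + b * (ev f x - ev h x)); last first.
  by rewrite mulrBl mulrBr addrA subrK.
have [b1 b2] : `|a - b| < 1 /\ `|a - b| < e / 2 / M.
  by move: Hb; rewrite lt_min => /andP.
rewrite (splitr e) (le_lt_trans (ler_normD _ _))// !normrM ler_ltD//.
  by rewrite (le_trans (ler_wpM2l _ (fM _ Kx)))// -ler_pdivlMr// ltW.
have ba : `|b| <= `|a| + 1.
  rewrite -[b](subrK a) addrC (le_trans (ler_normD _ _))// lerD2l distrC.
  exact: ltW.
rewrite (le_lt_trans (ler_wpM2r _ ba))// mulrC -ltr_pdivlMr//; exact: Hh.
Qed.

Lemma Ck_locally_convex : exists2 B : set_system (Ck R X),
  (forall b, b \in B -> convex_set b) & basis B.
Proof.
exists [set b | open b /\ convex_set b]; first by move=> b /set_mem[].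
split=> [b []//|f A /Ck_nbhsP[K [e [cK e0 KA]]]].
pose U : set (Ck R X) := [set h : Ck R X | forall x, K x -> `|ev h x| < e].
have oU : open U.
  exists [set h : {compact-open, X -> R} | h @` K `<=` ball (0 : R) e].
    by apply: compact_open_open => //; exact: ball_open.
  apply/seteqP; split => [h /= Hh x Kx|h Hh _ [x Kx <-]] /=.
    by have := Hh (ev h x); rewrite /ball/= sub0r normrN; apply; exists x.
  by rewrite /ball/= sub0r normrN; exact: Hh.
pose t (h : Ck R X) : Ck R X := h + (- f).
have ct : continuous t.
  move=> h B /Ck_nbhsP[C [d [cC d0 CB]]].
  apply/Ck_nbhsP; exists C, d; split=> // g Hg; apply: CB => x Cx.
  rewrite [X in `|X|](_ : _ = ev h x - ev g x); first exact: Hg.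
  transitivity ((ev h x - ev f x) - (ev g x - ev f x)); first by [].
  by rewrite opprB addrA subrK.
exists (t @^-1` U).
  split; last by move=> x Kx; rewrite /t subrr /Ck_fun/= normr0.
  split; first exact: open_comp.
  move=> h k l /set_mem Hh /set_mem Hk; apply/mem_set => x Kx.
  have /ltr_normlP[h1 h2] := Hh x Kx; have /ltr_normlP[k1 k2] := Hk x Kx.
  have hk0 (p q : R) : p < e -> q < e ->
      l%:num * p + (1 - l%:num) * q < e.
    move=> pe qe; have := @convR_gt0 _ (e - p) (e - q) l.
    rewrite !subr_gt0 => /(_ pe qe); rewrite convRE => H.
    rewrite -subr_gt0 (_ : _ - _ = l%:num * (e - p) + (1 - l%:num) * (e - q))//.
    by ring.
  have tE (g : Ck R X) : ev (t g) x = ev g x - ev f x by [].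
  have -> : ev (t (h <| l |> k)) x =
      l%:num * ev (t h) x + (1 - l%:num) * ev (t k) x.
    rewrite !tE (_ : ev (h <| l |> k) x =
      l%:num * ev h x + (1 - l%:num) * ev k x)//.
    by ring.
  apply/ltr_normlP; split; last exact: hk0.
  by rewrite opprD -!mulrN; exact: hk0.
move=> h Hh; apply: KA => x Kx; rewrite distrC; exact: Hh.
Qed.

(* PreTopologicalLmod_isTvs only provides the uniform structure. *)
HB.instance Definition _ := PreTopologicalNmodule_isTopologicalNmodule.Build
  (Ck R X) Ck_addr_continuous.
HB.instance Definition _ := TopologicalNmodule_isTopologicalLmodule.Build
  R (Ck R X) Ck_scaler_continuous.
HB.instance Definition _ := PreTopologicalLmod_isTvs.Build R (Ck R X)
  Ck_addr_continuous Ck_scaler_continuous Ck_locally_convex.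
HB.instance Definition _ := Uniform_isTvs.Build R (Ck R X) Ck_locally_convex.

End Ck_tvs.

Definition weak_space (R : realType) (E : tvsType R) : Type := E.

HB.instance Definition _ (R : realType) (E : tvsType R) :=
  Choice.copy (weak_space E) E.

HB.instance Definition _ (R : realType) (E : tvsType R) :=
  Topological.copy (weak_space E)
    (sup_topology (fun phi : {phi : {linear E -> R^o} | continuous phi} =>
      Topological.class (initial_topology (sval phi : E -> R^o)))).

(* Main.v *)
Require Import Defs.
From HB Require Import structures.
From mathcomp Require Import all_boot all_order all_algebra.
From mathcomp Require Import all_classical all_reals all_analysis.
From mathcomp Require Import ring lra.
Import Order.TTheory GRing.Theory Num.Theory.
Import numFieldNormedType.Exports.
Set Implicit Arguments.
Unset Strict Implicit.
Unset Printing Implicit Defensive.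
Local Open Scope classical_set_scope.
Local Open Scope ring_scope.

(** The proof runs around the cycle hemicompact, one-point compactification,
    metrizable C_k(X), Eberlein-Grothendieck weak topology, hemicompact.

    Let (K_n) witness that X, with distance d, is hemicompact. A sequence
    converging to x forms with x a compact set, which lies in some K_n, so some
    ball around x lies in some K_n. Hence [depth x], the supremum of the t for
    which the ball of radius t around x lies in some K_n with t <= 1/(n+1), is
    positive; it is 1-Lipschitz and, for e > 0, at least e only inside a finite
    union of the K_n. Using it as the distance to a new point gives an explicit
    metric on the one-point compactification. Conversely the complement of a
    point p in a compact metric space is hemicompact, by the sets of points at
    distance at least 1/(n+1) from p.

    If X is hemicompact, the compact-open topology is given by uniform
    convergence on each K_n, and [Ck_dist] is a distance for it.

    A metrizable C_k(X) has a countable base (U_n) of neighbourhoods of 0. Every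
    continuous functional belongs to the polar of some U_n, and these polars are
    compact for pointwise convergence (Alaoglu). The maps
    f |-> atan (phi f) / (n+1), for phi in the n-th polar, together with the
    zero map, form a set of functions on C_k(X) that is compact because the n-th
    part tends to 0 uniformly. Evaluation embeds the weak topology into C_p of
    this compact set, since atan can be undone.

    The last step is the substantial one. Let h embed (C_k(X), w) into C_p(K)
    with K compact. By definition of the two topologies, for each continuous
    functional phi there are m, n and an m-tuple of points of K such that
    |phi f| <= 1 as soon as h f is 1/(n+1)-close to h 0 at these points: the
    tuple controls phi. For given m and n, the supports of all phi controlled by
    some tuple have a union whose closure is compact. Otherwise there are
    functionals phi_j, m-tuples k_j controlling them, and functions f_j with
    phi_j f_j nonzero that vanish outside of a locally finite family of sets.
    Compactness of K gives a cluster point k of the k_j, and then a compact set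
    C such that each F vanishing on C has h F close to h 0 at k, hence at k_j
    for infinitely many j, so that |phi_j F| <= 1. But a gliding hump
    ([gliding_hump]) produces such an F with |phi_j F| >= 2 for all large j. The
    closures obtained are thus countably many compact sets, and they absorb
    every compact set C: the sum of the 2^-j times the Dirac functionals at a
    dense sequence of points of C is one of the phi, and its support contains
    C. *)

(** * Topological preliminaries *)

Lemma homeomorphic_sym (T U : topologicalType) :
  homeomorphic T U -> homeomorphic U T.
Proof. by move=> [f [g [fK gK cf cg]]]; exists g, f. Qed.

Lemma homeomorphic_hemicompact (T U : topologicalType) :
  homeomorphic T U -> hemicompact T -> hemicompact U.
Proof.
move=> [f [g [fK gK cf cg]]] [K [cK KP]].
exists (fun n => f @` K n); split=> [n|C cC].
  by apply: continuous_compact => //; exact: continuous_subspaceT.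
have /KP[n Kn] : compact (g @` C).
  by apply: continuous_compact => //; exact: continuous_subspaceT.
by exists n => x Cx; exists (g x); [apply: Kn; exists x|rewrite gK].
Qed.

Lemma nbhs_initialP (S : choiceType) (T : topologicalType) (f : S -> T)
    (x : initial_topology f) (A : set S) :
  nbhs x A <-> exists2 B, nbhs (f x) B & f @^-1` B `<=` A.
Proof.
split=> [|[B fxB BA]].
  rewrite nbhsE => -[_ [[B oB <-] /= Bx] BA].
  by exists B => //; exists B.
have : nbhs x (f @^-1` B) := @initial_continuous _ _ f x B fxB.
exact: filterS.
Qed.

Lemma compact_bigcup_lt (T : topologicalType) (K : nat -> set T) (N : nat) :
  (forall n, compact (K n)) -> compact (\bigcup_(n < N) K n).
Proof. by move=> cK; rewrite bigcup_mkord; exact: bigsetU_compact. Qed.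

(** Any neighbourhood of the limit leaves out only finitely many terms. *)
Lemma compact_cvg_range (T : topologicalType) (y : nat -> T) (x : T) :
  y @ \oo --> x -> compact (x |` range y).
Proof.
move=> yx; apply/compact_near_coveringP => I F P FF cov.
have [[U V] /= [xU FV] UV] := cov x (or_introl erefl).
have [N _ NU] := yx _ xU.
have : \forall i \near F, forall n : 'I_N, P i (y n).
  apply: filter_forall => n; have [|[U' V'] /= [yU' FV'] UV'] := cov (y n).
    by right; exists (val n).
  apply: filterS FV' => i Vi; apply: (UV' (y n, i)); split => //.
  exact: nbhs_singleton yU'.
apply: filterS2 FV => i Vi iN z [->|[n _ <-]].
  by apply: (UV (x, i)); split => //; exact: nbhs_singleton xU.
have [nN|nN] := ltnP n N; first exact: (iN (Ordinal nN)).
by apply: (UV (y n, i)); split => //; exact: NU.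
Qed.

Lemma compact_set_val (T : topologicalType) (S C : set T) :
  compact C -> C `<=` S -> compact (set_val @^-1` C : set (set_type S)).
Proof.
move=> cC CS F FF FC.
have PF : ProperFilter ((set_val : set_type S -> T) @ F).
  exact: fmap_proper_filter.
have [z [Cz Fz]] := cC _ PF FC.
exists (SigSub (mem_set (CS _ Cz))); split=> //.
move=> A B FA /nbhs_initialP[B' zB' B'B].
have FA' : ((set_val : set_type S -> T) @ F) (set_val @` A).
  by apply: (@filterS _ F _ A) => // a Aa; exists a.
have [_ [[a Aa <-] B'a]] := Fz _ _ FA' zB'.
by exists a; split=> //; exact: B'B.
Qed.

Lemma initial_cvgP (S : choiceType) (T : topologicalType) (f : S -> T)
    (F : set_system S) (x : S) : Filter F ->
  F --> (x : initial_topology f) <-> f @ F --> f x.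
Proof.
move=> FF; split=> [Fx B fxB|fFx A /nbhs_initialP[B fxB BA]].
  by apply: Fx; apply/nbhs_initialP; exists B.
by apply: (@filterS _ F _ (f @^-1` B)) => //; exact: fFx.
Qed.

(** The target space is arbitrary because this serves both for real functions and
    for finite tuples of points of a compact space. *)
Lemma ptws_cvgP (I : choiceType) (T : topologicalType)
    (F : set_system {ptws I -> T}) (f : {ptws I -> T}) : Filter F ->
  F --> f <-> forall i, (fun g => g i) @ F --> f i.
Proof.
move=> FF; split=> [/cvg_sup Ff i|Ff].
  exact: (initial_cvgP (fun g : I -> T => g i) f FF).1 (Ff i).
apply/cvg_sup => i.
exact: (initial_cvgP (fun g : I -> T => g i) f FF).2 (Ff i).
Qed.

(** * Topologies given by a distance *)

Record distance (R : realType) (T : Type) (d : T -> T -> R) : Prop := Distance {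
  dist0 : forall x, d x x = 0 ;
  dist_eq : forall x y, d x y = 0 -> x = y ;
  distS : forall x y, d x y = d y x ;
  dist_tri : forall y x z, d x z <= d x y + d y z }.

(** An alias of T that depends on the axioms of d, so that the metric structure
    can be attached to it. *)
Definition dist_space (R : realType) (T : choiceType) (d : T -> T -> R)
  (dP : distance d) : Type := T.

Section dist_space.
Context (R : realType) (T : choiceType) (d : T -> T -> R) (dP : distance d).
HB.instance Definition _ := Choice.on (dist_space dP).
HB.instance Definition _ := isMetric.Build R (dist_space dP)
  (dist0 dP) (dist_eq dP) (distS dP) (dist_tri dP).
End dist_space.

(** Describing a metrizable topology by a distance on the given carrier avoids
    transporting compact sets and function spaces along homeomorphisms. *)
Definition metrizes (R : realType) (T : topologicalType) (d : T -> T -> R) :=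
  distance d /\ forall x A, nbhs x A <->
    exists2 e, 0 < e & forall y, d x y < e -> A y.

Lemma nbhs_distP (R : realType) (T : topologicalType) (d : T -> T -> R) :
  metrizes d -> forall x A, nbhs x A <->
    exists2 e, 0 < e & forall y, d x y < e -> A y.
Proof. by case. Qed.

Lemma metric_metrizes (R : realType) (M : metricType R) :
  metrizes (@mdist R M).
Proof.
split.
  split; [exact: mdistxx|exact: mdist_positivity|exact: metric_sym|].
  by move=> y x z; exact: metric_triangle.
move=> x A; split=> [/nbhs_ballP[e /= e0 eA]|[e e0 eA]].
  by exists e => // y; move: eA; rewrite ballEmdist => /(_ y).
by apply/nbhs_ballP; exists e => //=; rewrite ballEmdist.
Qed.

Lemma dist_space_metrizes (R : realType) (T : choiceType) (d : T -> T -> R)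
  (dP : distance d) : @metrizes R (dist_space dP) d.
Proof. exact: (metric_metrizes (dist_space dP)). Qed.

Section metrizes.
Context (R : realType) (T : topologicalType) (d : T -> T -> R).
Hypothesis dT : metrizes d.
Let dP : distance d := dT.1.

Lemma dist_ge0 x y : 0 <= d x y.
Proof.
have := dist_tri dP y x x; rewrite (dist0 dP) (distS dP y x); lra.
Qed.

Lemma nbhs_dist x e : 0 < e -> nbhs x [set y | d x y < e].
Proof. by move=> e0; apply/(nbhs_distP dT); exists e. Qed.

Lemma metrizes_metrizable : metrizable R T.
Proof.
exists (dist_space dP), id, id; split=> // x A.
  by move/(nbhs_distP (dist_space_metrizes dP)) => H; apply/(nbhs_distP dT).
by move/(nbhs_distP dT) => H; apply/(nbhs_distP (dist_space_metrizes dP)).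
Qed.
End metrizes.

Lemma homeomorphic_metrizes (R : realType) (T U : topologicalType)
    (d : U -> U -> R) (f : T -> U) (g : U -> T) :
  cancel f g -> cancel g f -> continuous f -> continuous g ->
  metrizes d -> metrizes (fun x y => d (f x) (f y)).
Proof.
move=> fK gK cf cg dU; have dP := dU.1; split.
  split.
  - by move=> x; exact: (dist0 dP).
  - by move=> x y /(dist_eq dP)/(can_inj fK).
  - by move=> x y; exact: (distS dP).
  - by move=> y x z; exact: (dist_tri dP).
move=> x A; split=> [xA|[e e0 eA]].
  have : nbhs (g (f x)) A by rewrite fK.
  move=> /cg/(nbhs_distP dU)[e e0 eA]; exists e => // y /eA /=.
  by rewrite fK.
have : nbhs x (f @^-1` [set y | d (f x) y < e]) := cf x _ (nbhs_dist dU (f x) e0).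
apply: filterS => y /=; exact: eA.
Qed.

Lemma metrizableP (R : realType) (T : topologicalType) :
  metrizable R T <-> exists d : T -> T -> R, metrizes d.
Proof.
split=> [[M [f [g [fK gK cf cg]]]]|[d dT]]; last exact: metrizes_metrizable dT.
exists (fun x y => mdist (f x) (f y)).
exact: homeomorphic_metrizes fK gK cf cg (metric_metrizes M).
Qed.

(** * The one-point compactification of a hemicompact metrizable space *)

Section one_point.
Context (R : realType) (X : topologicalType) (d : X -> X -> R).
Hypothesis dX : metrizes d.
Variable K : nat -> set X.
Hypothesis cK : forall n, compact (K n).
Hypothesis hK : forall C, compact C -> exists n, C `<=` K n.

Let dP := dX.1.
Let d_ge0 := dist_ge0 dX.

Let depth_set x := [set t : R | 0 <= t /\
  exists2 n, t <= n.+1%:R^-1 & forall y, d x y < t -> K n y].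

(** The distance from x to infinity. The condition t <= 1/(n+1) is what makes
    the depth small outside of finitely many K n. *)
Definition depth x : R := sup (depth_set x).

Let depth_set0 x : depth_set x 0.
Proof.
split=> //; exists 0%N => // y.
by rewrite ltNge d_ge0.
Qed.

Let depth_setP x : has_sup (depth_set x).
Proof.
split; first by exists 0.
exists 1 => t [t0 [n tn _]]; apply: (le_trans tn).
by rewrite invf_le1 ?ltr0n// ler1n.
Qed.

Let depth_ub x t : depth_set x t -> t <= depth x.
Proof. by move=> xt; apply: sup_upper_bound. Qed.

Lemma depth_ge0 x : 0 <= depth x.
Proof. exact: depth_ub. Qed.

(** The ball of radius t - d x y around y is contained in the ball of radius t
    around x. *)
Lemma depth_lipschitz x y : depth x <= depth y + d x y.
Proof.
apply: ge_sup; first by exists 0.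
move=> t [t0 [n tn xK]]; have [tx|xt] := leP t (d x y).
  by have := depth_ge0 y; lra.
suff: t - d x y <= depth y by lra.
apply: depth_ub; split; first lra.
exists n; first by apply: le_trans tn; have := d_ge0 x y; lra.
move=> z yz; apply: xK; have := dist_tri dP y x z; lra.
Qed.

(** Otherwise there are points y n outside of K n and converging to x; together
    with x they form a compact set contained in no K n. *)
Lemma depth_gt0 x : 0 < depth x.
Proof.
rewrite lt_neqAle depth_ge0 andbT; apply/negP => /eqP/esym dx0.
have bad n : exists y, d x y < n.+1%:R^-1 /\ ~ K n y.
  apply: contrapT => /forallNP no.
  have : n.+1%:R^-1 <= depth x.
    apply: depth_ub; split=> //; exists n => // y xy.
    by apply: contrapT => Ky; apply: (no y).
  by rewrite dx0 leNgt invr_gt0 ltr0n.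
have [y yP] := choice bad.
have /compact_cvg_range/hK[n yK] : y @ \oo --> x.
  move=> A /(nbhs_distP dX)[e e0 eA].
  have : \forall n \near \oo, n.+1%:R^-1 < e by exact:
      near_infty_natSinv_lt (PosNum e0).
  apply: filterS => n ne; apply: eA; apply: lt_trans ne; exact: (yP n).1.
by have [_] := yP n; apply; apply: yK; right; exists n.
Qed.

Lemma depth_ge_compact e : 0 < e ->
  exists2 C, compact C & forall x, e <= depth x -> C x.
Proof.
move=> e0; exists (\bigcup_(n < Num.bound (e / 2)^-1) K n).
  exact: compact_bigcup_lt.
move=> x ex; have e20 : 0 < e / 2 by lra.
have [t [t0 [n tn xK]] et] := sup_adherent e20 (depth_setP x).
have {}et : e / 2 < t by move: et; rewrite -/(depth x); lra.
exists n; last by apply: xK; rewrite (dist0 dP); lra.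
rewrite /= -(ler_nat R); apply: ltW.
have h : n.+1%:R < (e / 2)^-1.
  rewrite -[ltLHS]invrK ltf_pV2 ?posrE ?invr_gt0 ?ltr0n//.
  exact: lt_le_trans et tn.
apply: (lt_le_trans h).
have := archi_boundP (ltW (_ : 0 < (e / 2)^-1)).
rewrite invr_gt0 => /(_ e20) /ltW /le_trans; apply.
by rewrite ler_nat.
Qed.

(** Two finite points are joined either directly or through infinity; the
    triangle inequality is the Lipschitz property of the depth. *)
Definition one_point_dist (u v : option X) : R :=
  match u, v with
  | Some x, Some y => Num.min (d x y) (depth x + depth y)
  | Some x, None => depth x
  | None, Some y => depth y
  | None, None => 0
  end.

Lemma one_point_distP : distance one_point_dist.
Proof.
split.
- move=> [x|] //=; rewrite (dist0 dP) min_l//.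
  by have := depth_ge0 x; lra.
- move=> [x|] [y|] //=.
  + rewrite minElt; case: ifP => _; first by move/(dist_eq dP) ->.
    by have := depth_gt0 x; have := depth_gt0 y => ? ? ?; exfalso; lra.
  + by have := depth_gt0 x => ? ?; exfalso; lra.
  + by have := depth_gt0 y => ? ?; exfalso; lra.
- move=> [x|] [y|] //=; by rewrite (distS dP) addrC.
- move=> [y|] [x|] [z|] /=.
  + have := dist_tri dP y x z; have := depth_lipschitz x y.
    have := depth_lipschitz y x; have := depth_lipschitz z y.
    have := depth_lipschitz y z; rewrite (distS dP z y) (distS dP y x).
    have := depth_ge0 x; have := depth_ge0 y; have := depth_ge0 z.
    by rewrite !minElt; do 3 case: ltP => ?; lra.
  + have := depth_lipschitz x y; have := depth_ge0 y; rewrite minElt.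
    by case: ltP => ?; lra.
  + have := depth_lipschitz z y; have := depth_ge0 y; rewrite minElt (distS dP).
    by case: ltP => ?; lra.
  + by have := depth_ge0 y; lra.
  + by rewrite minElt; case: ltP => ?; lra.
  + by lra.
  + by lra.
  + by lra.
Qed.

Let Y : metricType R := dist_space one_point_distP.

Let Some_continuous : continuous (Some : X -> Y).
Proof.
move=> x A /(nbhs_distP (dist_space_metrizes one_point_distP))[e e0 eA].
apply: filterS (nbhs_dist dX x e0) => y /= xy; apply: eA => /=.
by rewrite gt_min xy.
Qed.

(** A filter without cluster point at infinity contains a set of points of depth
    at least e, which lies in a compact set. *)
Lemma one_point_compact : compact [set: Y].
Proof.
move=> F PF _; have [|Fnone] := pselect (cluster F (None : Y)).
  by exists None.
have [A [B [FA [e e0 eB] AB]]] : exists A B, [/\ F A,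
    exists2 e, 0 < e & forall y, one_point_dist None y < e -> B y
    & A `&` B = set0].
  apply: contrapT => no; apply: Fnone => A B FA.
  move=> /(nbhs_distP (dist_space_metrizes one_point_distP)) H.
  apply/set0P/eqP => AB; apply: no; by exists A, B.
have [C cC CP] := depth_ge_compact e0.
have cSC : compact (Some @` C : set Y).
  by apply: continuous_compact => //; exact: continuous_subspaceT.
have [|z [_ Fz]] := cSC F PF; last by exists z.
apply: filterS FA => -[x|] Ax.
  exists x => //; apply: CP; rewrite leNgt; apply/negP => xe.
  have : (A `&` B) (Some x) by split => //; exact: eB.
  by rewrite AB.
have : (A `&` B) None by split => //; exact: eB.
by rewrite AB.
Qed.

Lemma one_point_nonisolated : ~ compact [set: X] -> ~ isolated [set: Y] None.
Proof.
move=> ncX [_ [V /(nbhs_distP (dist_space_metrizes one_point_distP))[e e0 eV] VE]].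
have [C cC CP] := depth_ge_compact e0; apply: ncX.
rewrite (_ : setT = C)//; apply/seteqP; split=> // x _; apply: CP.
rewrite leNgt; apply/negP => xe.
have : (V `&` [set: Y]) (Some x) by split => //; exact: eV.
by rewrite VE.
Qed.

Lemma one_point_homeomorphic (x0 : X) :
  homeomorphic X (set_type [set~ (None : Y)]).
Proof.
have SN x : (Some x : Y) \in [set~ (None : Y)] by rewrite inE.
pose f x : set_type [set~ (None : Y)] := SigSub (SN x).
pose g (u : set_type [set~ (None : Y)]) := if val u is Some x then x else x0.
exists f, g; split=> //.
- by move=> [[x|] uP]; apply: val_inj => //=; case: (set_mem uP).
- move=> x A /nbhs_initialP[B fxB BA].
  have : nbhs x ((Some : X -> Y) @^-1` B) := Some_continuous fxB.
  by apply: filterS => y; exact: (BA (f y)).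
- move=> u A; rewrite nbhs_simpl /=.
  have : val u <> None by exact: set_valP u.
  case E : (val u) => [x|]// _; rewrite /g E => /(nbhs_distP dX)[e e0 eA].
  apply/nbhs_initialP;
    exists [set v | one_point_dist (Some x) v < Num.min e (depth x)].
    rewrite [set_val u]E; apply: (nbhs_dist (dist_space_metrizes one_point_distP)).
    by rewrite lt_min e0 depth_gt0.
  move=> v /=; rewrite lt_min => /andP[]; rewrite /set_val/=.
  case: (val v) => [y|] /=; last by rewrite ltxx.
  have := depth_ge0 y; rewrite !gt_min => y0 xye xyx; apply: eA.
  by case/orP: xye => //; case/orP: xyx; lra.
Qed.

End one_point.

Lemma hemicompact_one_point (R : realType) (X : topologicalType) :
  metrizable R X -> hemicompact X -> ~ compact [set: X] ->
  exists (K : topologicalType) (p : K),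
    [/\ metrizable R K, compact [set: K], ~ isolated [set: K] p
      & homeomorphic X (set_type [set~ p])].
Proof.
move=> /metrizableP[d dX] [K [cK hK]] ncX.
have [x0 _] : [set: X] !=set0.
  by apply/set0P/eqP => X0; apply: ncX; rewrite X0; exact: compact0.
exists (dist_space (one_point_distP dX hK)), None; split.
- exact: metrizes_metrizable (dist_space_metrizes (one_point_distP dX hK)).
- exact: one_point_compact.
- exact: one_point_nonisolated.
- exact: one_point_homeomorphic.
Qed.

Lemma punctured_hemicompact (R : realType) (K : topologicalType)
    (d : K -> K -> R) (p : K) :
  metrizes d -> compact [set: K] -> hemicompact (set_type [set~ p]).
Proof.
move=> dK cK; have dP := dK.1.
pose far n := [set x : K | n.+1%:R^-1 <= d x p].
have clfar n : closed (far n).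
  move=> x xfar; rewrite /far /= leNgt; apply/negP => xn.
  have e0 : 0 < n.+1%:R^-1 - d x p by rewrite subr_gt0.
  have [y []] := xfar _ (nbhs_dist dK x e0).
  move: e0; rewrite /far /=; set w := _^-1 => e0.
  have := dist_tri dP x y p; rewrite (distS dP y x); lra.
exists (fun n => set_val @^-1` far n); split=> [n|C cC].
  apply: compact_set_val; first exact: (subclosed_compact _ cK).
  move=> x; rewrite /far /= => xn xp; move: xn.
  by rewrite xp (dist0 dP) leNgt invr_gt0 ltr0n.
have /compact_near_coveringP cov :
    compact ((set_val : set_type [set~ p] -> K) @` C).
  apply: continuous_compact => //; apply: continuous_subspaceT.
  exact: initial_continuous.
have [n nP] : exists n, set_val @` C `<=` far n.
  suff /filter_ex[n nP] : \forall n \near \oo, set_val @` C `<=` far n.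
    by exists n.
  apply: cov => _ [u _ <-].
  have u0 : 0 < d (set_val u) p.
    rewrite lt_neqAle (dist_ge0 dK) andbT eq_sym; apply/eqP.
    by move/(dist_eq dP); exact: (set_valP u).
  have u20 : 0 < d (set_val u) p / 2 by lra.
  exists ([set x | d (set_val u) x < d (set_val u) p / 2],
          [set n | n.+1%:R^-1 < d (set_val u) p / 2]).
    split; first exact: nbhs_dist.
    exact: near_infty_natSinv_lt (PosNum u20).
  move=> [x n] [/= ux nu]; rewrite /far /=.
  apply: ltW; apply: (lt_le_trans nu).
  have := dist_tri dP x (set_val u) p; lra.
by exists n => u Cu; apply: nP; exists u.
Qed.

(** * Metrizability of C_k of a hemicompact space *)

Section Ck_metrizable.
Context (R : realType) (X : topologicalType) (K : nat -> set X).
Hypothesis cK : forall n, compact (K n).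
Hypothesis hK : forall C, compact C -> exists n, C `<=` K n.
Implicit Types f g h : Ck R X.

Let ev := @Ck_fun R X.

Let bounds f g := [set t : R | 0 <= t /\
  forall n, t < n.+1%:R^-1 -> forall x, K n x -> `|ev f x - ev g x| <= t].

(** A single bound t serves for the closeness of f and g and for the number of
    sets K n taken into account. For a given t > 0 these are finitely many, so
    that balls are neighbourhoods in the compact-open topology. *)
Definition Ck_dist f g : R := inf (bounds f g).

Let bounds_inf f g : has_inf (bounds f g).
Proof.
split; last by exists 0 => t [].
exists 1; split=> // n; rewrite ltNge invf_le1 ?ltr0n// ler1n//.
Qed.

Let dist_le f g t : bounds f g t -> Ck_dist f g <= t.
Proof. by move=> fgt; apply: ge_inf => //; exact: (bounds_inf f g).2. Qed.

Let dist_lt f g e : Ck_dist f g < e -> exists2 t, bounds f g t & t < e.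
Proof.
move=> fge; have e0 : 0 < e - Ck_dist f g by rewrite subr_gt0.
have [t fgt te] := inf_adherent e0 (bounds_inf f g).
by exists t => //; move: te; rewrite -/(Ck_dist f g) addrC subrK.
Qed.

Let dist_ge0 f g : 0 <= Ck_dist f g.
Proof. by apply: lb_le_inf => //; [exact: (bounds_inf f g).1|move=> t []]. Qed.

Lemma Ck_distP : distance Ck_dist.
Proof.
split.
- move=> f; apply/eqP; rewrite eq_le dist_ge0 andbT; apply: dist_le.
  by split=> // n _ x _; rewrite subrr normr0.
- move=> f g fg0; apply/continuousEP => x.
  have [n xn] := hK (@compact_set1 _ x).
  apply/eqP; rewrite -subr_eq0 -normr_le0; apply/ler_addgt0Pl => e e0.
  rewrite addr0.
  have : Ck_dist f g < Num.min e n.+1%:R^-1.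
    by rewrite fg0 lt_min e0 invr_gt0 ltr0n.
  move=> /dist_lt[t [t0 fgt]]; rewrite lt_min => /andP[te tn].
  by apply: le_trans (ltW te); exact: fgt (xn _ erefl).
- move=> f g; congr inf; apply/seteqP; split=> t [t0 fgt]; split=> // n tn x Kx;
    rewrite distrC; exact: fgt Kx.
- move=> g f h; apply/ler_addgt0Pl => e e0.
  have e20 : 0 < e / 2 by lra.
  have [t [t0 fgt] te] : exists2 t, bounds f g t & t < Ck_dist f g + e / 2.
    by apply: dist_lt; lra.
  have [s [s0 ghs] se] : exists2 t, bounds g h t & t < Ck_dist g h + e / 2.
    by apply: dist_lt; lra.
  suff : Ck_dist f h <= t + s by lra.
  apply: dist_le; split=> [|n tsn x Kx]; first lra.
  have tn : t < n.+1%:R^-1 by apply: le_lt_trans tsn; lra.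
  have sn : s < n.+1%:R^-1 by apply: le_lt_trans tsn; lra.
  rewrite -(subrKA (ev g x)) (le_trans (ler_normD _ _))// lerD//.
    exact: fgt Kx.
  exact: ghs Kx.
Qed.

Lemma Ck_dist_metrizes : metrizes Ck_dist.
Proof.
split=> [|f A]; first exact: Ck_distP.
split=> [/Ck_nbhsP[C [e [/hK[n Cn] e0 CA]]]|[e e0 eA]].
  exists (Num.min e n.+1%:R^-1); first by rewrite lt_min e0 invr_gt0 ltr0n.
  move=> g /dist_lt[t [t0 fgt]]; rewrite lt_min => /andP[te tn].
  apply: CA => x Cx; apply: le_lt_trans te; exact: fgt (Cn _ Cx).
apply/Ck_nbhsP; exists (\bigcup_(n < Num.bound (e / 2)^-1) K n), (e / 2).
have e20 : 0 < e / 2 by lra.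
split=> //; first exact: compact_bigcup_lt.
move=> g fg; apply: eA; suff : Ck_dist f g <= e / 2 by lra.
apply: dist_le; split=> [|n en x Kx]; first exact: ltW.
apply/ltW/fg; exists n => //=.
rewrite -(ltr_nat R).
have ne : n.+1%:R < (e / 2)^-1.
  by rewrite -[ltLHS]invrK ltf_pV2 ?posrE ?invr_gt0 ?ltr0n.
have e2V : 0 <= (e / 2)^-1 by rewrite invr_ge0 ltW.
by apply: lt_trans (archi_boundP e2V); apply: lt_trans ne; rewrite ltr_nat.
Qed.

End Ck_metrizable.

Lemma hemicompact_Ck_metrizable (R : realType) (X : topologicalType) :
  hemicompact X -> metrizable R (Ck R X).
Proof.
move=> [K [cK hK]].
exact: (metrizes_metrizable (@Ck_dist_metrizes R X K cK hK)).
Qed.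

(** * Convergence in weak topologies and in C_p *)

Lemma weak_cvgP (R : realType) (E : tvsType R)
    (F : set_system (weak_space E)) (x : E) : Filter F ->
  F --> (x : weak_space E) <-> forall phi : {linear E -> R^o},
    continuous phi -> phi @ F --> phi x.
Proof.
move=> FF; split=> [/cvg_sup Fx phi cphi|Fx].
  have := Fx (exist _ phi cphi).
  by move=> /(initial_cvgP (phi : E -> R^o) x FF).1.
apply/cvg_sup => -[phi cphi].
exact: (initial_cvgP (phi : E -> R^o) x FF).2 (Fx phi cphi).
Qed.

Definition Cp_fun (R : realType) (K : topologicalType) (f : Cp R K) : K -> R :=
  (f : continuousType K R).

Lemma Cp_cvgP (R : realType) (K : topologicalType)
    (F : set_system (Cp R K)) (f : Cp R K) : Filter F ->
  F --> f <-> forall k, (fun g : Cp R K => Cp_fun g k) @ F --> Cp_fun f k.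
Proof.
move=> FF; have := initial_cvgP
  (fun g : continuousType K R => (g : {ptws K -> R})) f FF.
move=> ->.
exact: ptws_cvgP.
Qed.

(** The last condition says that the inverse of e is continuous on its range. *)
Lemma embedding_embeds_in (T U : topologicalType) (e : T -> U) :
  injective e -> continuous e ->
  (forall x A, nbhs x A -> exists2 B, nbhs (e x) B & e @^-1` B `<=` A) ->
  embeds_in T U.
Proof.
move=> einj ce eopen; exists (range e).
have eP x : e x \in range e by rewrite inE; exists x.
pose f x : set_type (range e) := SigSub (eP x).
have gP (u : set_type (range e)) : exists x, e x = val u.
  by have [x _ xu] := set_valP u; exists x.
have [g gE] := choice gP.
exists f, g; split.
- by move=> x; apply: einj; rewrite gE.
- by move=> u; apply: val_inj; rewrite /= gE.
- move=> x A /nbhs_initialP[B fxB BA].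
  have : nbhs x (e @^-1` B) := ce x B fxB.
  by apply: filterS => y; exact: (BA (f y)).
- move=> u A; rewrite nbhs_simpl /= => /eopen[B]; rewrite gE => uB BA.
  apply/nbhs_initialP; exists B => // v vB; apply: BA.
  by rewrite /preimage /= gE.
Qed.

(** The sets of functions close to f at finitely many points form the base of a
    filter that converges to f pointwise. *)
Lemma Cp_nbhs_finite (R : realType) (K : topologicalType) (f : Cp R K)
    (B : set (Cp R K)) : nbhs f B ->
  exists m (k : 'I_m -> K) n, forall g,
    (forall i, `|Cp_fun g (k i) - Cp_fun f (k i)| < n.+1%:R^-1) -> B g.
Proof.
pose basic (p : seq K * nat) := [set g : Cp R K | forall k, k \in p.1 ->
  `|Cp_fun g k - Cp_fun f k| < p.2.+1%:R^-1].
pose F := filter_from [set: seq K * nat] basic.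
have FF : Filter F.
  apply: filter_from_filter; first by exists ([::], 0%N).
  move=> [s m] [t n] _ _; exists (s ++ t, maxn m n) => // g gP.
  have le (i : nat) : (i <= maxn m n)%N -> ((maxn m n).+1%:R^-1 : R) <= i.+1%:R^-1.
    by move=> im; rewrite lef_pV2 ?posrE ?ltr0n// ler_nat.
  split=> k /= ks.
    apply: lt_le_trans (le m _); last exact: leq_maxl.
    by apply: gP; rewrite mem_cat ks.
  apply: lt_le_trans (le n _); last exact: leq_maxr.
  by apply: gP; rewrite mem_cat ks orbT.
have Ff : F --> f.
  apply/Cp_cvgP => k; apply/cvgrPdist_lt => e e0.
  have [N _ /(_ N (leqnn N)) /= Ne] := near_infty_natSinv_lt (PosNum e0).
  exists ([:: k], N) => // g /(_ k (mem_head _ _)) /= gk.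
  by rewrite distrC; exact: lt_trans Ne.
move=> /Ff[[s n] _ sB]; exists (size s), (tnth (in_tuple s)), n => g gP.
apply: sB => k /(nthP k)[i si <-].
by have := gP (Ordinal si); rewrite (tnth_nth k).
Qed.

Lemma nbhs_weak (R : realType) (E : tvsType R) (x : E) :
  nbhs x --> (x : weak_space E).
Proof. by apply/weak_cvgP => phi; apply. Qed.

(** * Spaces with a countable base at zero are weakly Eberlein-Grothendieck *)

Section polars.
Context (R : realType) (E : tvsType R) (U : nat -> set E).
Hypothesis U0 : forall n, nbhs (0 : E) (U n).
Hypothesis Ubase : forall A, nbhs (0 : E) A -> exists n, U n `<=` A.
Hypothesis sep : forall x y : E,
  (forall phi : {linear E -> R^o}, continuous phi -> phi x = phi y) -> x = y.

(** The polar of U n, as a set of plain functions in order to give it the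
    topology of pointwise convergence. *)
Definition polar n : set {ptws E -> R} := [set psi : {ptws E -> R} |
  exists2 phi : {linear E -> R^o},
  psi = (phi : E -> R) & forall x, U n x -> `|phi x| <= 1].

Lemma polar_continuous n (phi : {linear E -> R^o}) :
  (forall x, U n x -> `|phi x| <= 1) -> continuous phi.
Proof.
move=> phiU x A /nbhs_ballP[e /= e0 eA].
have e20 : e / 2 != 0 :> R by rewrite gt_eqF// divr_gt0.
have : nbhs x (+%R x @` ( *:%R (e / 2) @` U n)).
  by apply: nbhsT; apply: nbhs0Z.
apply: filterS => _ [_ [y Uy <-] <-]; apply: eA.
rewrite /ball /= linearD linearZ /= opprD addNKr normrN normrM.
rewrite gtr0_norm ?divr_gt0//; have := phiU _ Uy.
have := normr_ge0 (phi y); rewrite /GRing.scale/=; nra.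
Qed.

Lemma continuous_polar (phi : {linear E -> R^o}) :
  continuous phi -> exists n, polar n phi.
Proof.
move=> cphi; have [|n nP] := Ubase (A := [set x | `|phi x| < 1]).
  have B0 : nbhs (phi 0) (ball (0 : R) 1) by rewrite linear0; exact: nbhsx_ballx.
  have : nbhs (0 : E) (phi @^-1` ball (0 : R) 1) := cphi 0 _ B0.
  by apply: filterS => x; rewrite /ball /= sub0r normrN.
by exists n, phi => // x /nP /ltW.
Qed.

Lemma polar_bounded n x : exists c, forall psi, polar n psi -> `|psi x| <= c.
Proof.
have /= := @scale_continuous R E (0, x) (U n).
rewrite scale0r => /(_ (U0 n))[[B C] /= [/nbhs_ballP[e /= e0 eB] Cx] BCU].
have e20 : 0 < e / 2 by rewrite divr_gt0.
exists (e / 2)^-1 => _ [phi -> phiU].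
have /phiU : U n ((e / 2) *: x).
  apply: (BCU (e / 2, x)); split; last exact: nbhs_singleton.
  by apply: eB; rewrite /ball /= sub0r normrN gtr0_norm//; lra.
rewrite linearZ /= normrM gtr0_norm// => H.
by rewrite -[leRHS]mul1r ler_pdivlMr// mulrC.
Qed.

(** Alaoglu's theorem: since U n is absorbing, the polar lies in a product of
    segments, and its defining conditions pass to pointwise limits. *)
Lemma polar_compact n : compact (polar n).
Proof.
have [c cP] := choice (polar_bounded n).
rewrite compact_ultra => F FU FP.
have := @tychonoff E (fun=> R) (fun x => `[- c x, c x]%classic)
  (fun x => @segment_compact _ _ _).
rewrite compact_ultra => /(_ F FU)[|psi [_ /= Fpsi]].
  apply: filterS FP => phi /= phiP x.
  by rewrite /= in_itv /= -ler_norml; exact: cP.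
have FF : ProperFilter F by exact: ultra_proper.
have ev x : (fun g : E -> R => g x) @ F --> psi x by exact: (ptws_cvgP _ _).1.
exists psi; split=> //.
have lin : linear (psi : E -> R^o).
  move=> a x y; apply: (cvg_unique (@Rhausdorff R) (ev (a *: x + y))).
  apply: (@cvg_trans _ ((fun g : E -> R => a * g x + g y) @ F)).
    apply: near_eq_cvg.
    by apply: filterS FP => _ [phi -> _]; rewrite linearP.
  by apply: cvgD; [apply: cvgMr|]; exact: ev.
pose phi : {linear E -> R^o} := HB.pack psi (GRing.isLinear.Build _ _ _ _ psi lin).
exists phi => // x Ux.
have L : (fun g : E -> R => `|g x|) @ F --> `|psi x| by apply: cvg_norm; exact: ev.
have C : closed [set r : R | r <= 1] by exact: closed_le.
apply: (@closed_cvg _ _ F _ (fun g : E -> R => `|g x|)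
  [set r : R | r <= 1] C _ _ L).
by apply: filterS FP => _ [p -> pU]; exact: pU.
Qed.

(** The arctangent keeps the topological information of psi but is bounded, so
    that the factor 1 / (n + 1) makes the image of the n-th polar uniformly
    small. *)
Definition squash n (psi : {ptws E -> R}) : {ptws E -> R} :=
  fun x => n.+1%:R^-1 * atan (psi x).

Lemma squash_continuous n : continuous (squash n).
Proof.
move=> psi.
have FF : Filter (squash n @ nbhs psi) by exact: fmap_filter.
have H := (@ptws_cvgP E R (squash n @ nbhs psi) (squash n psi) FF).2.
refine (H _).
move=> x.
apply: cvgMr; apply: continuous_cvg; first exact: continuous_atan.
exact: (ptws_cvgP _ _).1.
Qed.

Definition squashed : set {ptws E -> R} :=
  [set (fun=> 0)] `|` \bigcup_n squash n @` polar n.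

(** If a filter does not cluster at 0, it avoids a neighbourhood of 0, which
    contains all but finitely many of the compact pieces. *)
Lemma squashed_compact : compact squashed.
Proof.
move=> F PF FK; have [|Fnone] := pselect (cluster F ((fun=> 0) : {ptws E -> R})).
  by exists (fun=> 0); split=> //; left.
have [A [B [FA B0 AB]]] : exists A B, [/\ F A,
    nbhs ((fun=> 0) : {ptws E -> R}) B & A `&` B = set0].
  apply: contrapT => no; apply: Fnone => A B FA B0.
  by apply/set0P/eqP => AB; apply: no; exists A, B.
have B00 : B (fun=> 0) := nbhs_singleton B0.
pose tail N : set {ptws E -> R} :=
  \bigcup_(n in [set n | (N <= n)%N]) range (squash n).
pose G := filter_from [set: nat] tail.
have FG : Filter G.
  apply: filter_from_filter; first by exists 0%N.
  move=> i j _ _; exists (maxn i j) => // psi [n]; rewrite /= geq_max.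
  by move=> /andP[ni nj] psin; split; exists n.
(* The tails converge to 0, so one of them is contained in B. *)
have [N _ NB] : G B.
  suff : G --> ((fun=> 0) : {ptws E -> R}) by apply.
  apply/ptws_cvgP => x.
  apply/cvgrPdist_lt => e e0.
  have e20 : 0 < e / 2 by lra.
  have [N _ NP] := near_infty_natSinv_lt (PosNum e20).
  exists N => // _ [n Nn [psi _ <-]] /=.
  rewrite /squash sub0r normrN normrM gtr0_norm ?invr_gt0 ?ltr0n//.
  have := NP n Nn; rewrite /=.
  have : `|atan (psi x)| < 2.
    rewrite ltr_norml; have := atan_gtNpi2 (psi x); have := atan_ltpi2 (psi x).
    by have := pihalf_lt2 R; lra.
  have : 0 < n.+1%:R^-1 :> R by rewrite invr_gt0 ltr0n.
  move: (n.+1%:R^-1 : R) => w; have := normr_ge0 (atan (psi x)); nra.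
have cN : compact (\bigcup_(n < N) squash n @` polar n).
  apply: compact_bigcup_lt => n.
  apply: continuous_compact; last exact: polar_compact.
  by apply: continuous_subspaceT; exact: squash_continuous.
have [|z [[n nN nz] Fz]] := cN F PF; last first.
  by exists z; split=> //; right; exists n.
apply: filterS2 FA FK => psi Apsi [psi0|[n _ npsi]].
  have : (A `&` B) psi by split=> //; rewrite psi0.
  by rewrite AB.
exists n => //=; rewrite ltnNge; apply/negP => Nn.
have : (A `&` B) psi.
  by split=> //; apply: NB; exists n => //; case: npsi => p _ <-; exists p.
by rewrite AB.
Qed.

Let K : topologicalType := set_type squashed.

Lemma squashed_tychonoff : tychonoff_space K.
Proof.
split; first exact: (@uniform_completely_regular R (set_type squashed)).
have H : hausdorff_space {ptws E -> R}.
  by apply: hausdorff_product => x; exact: Rhausdorff.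
move=> u v uv; apply: val_inj; apply: H => A B uA vB.
have [||w [wA wB]] := uv (set_val @^-1` A) (set_val @^-1` B).
- by apply/nbhs_initialP; exists A.
- by apply/nbhs_initialP; exists B.
- by exists (set_val w).
Qed.

Lemma eval_continuous (x : E) : continuous (fun k : K => set_val k x).
Proof.
move=> k.
have FF : Filter ((set_val : K -> {ptws E -> R}) @ nbhs k) by exact: fmap_filter.
exact: (@ptws_cvgP E R _ (set_val k) FF).1
  (@initial_continuous K _ (set_val : K -> {ptws E -> R}) k) x.
Qed.

Definition eval_Cp (x : E) : Cp R K :=
  (mkcts (@eval_continuous x) : continuousType K R).

(** The topology induced by C_p(K) makes the maps atan o phi continuous, for all
    continuous functionals phi, hence the functionals themselves. *)
Lemma countable_base_eberlein_grothendieck :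
  eberlein_grothendieck R (weak_space E).
Proof.
exists K; split; first exact: squashed_tychonoff.
  rewrite [X in compact X](_ : _ = set_val @^-1` squashed).
    exact: compact_set_val squashed_compact _.
  by apply/seteqP; split=> // k _; exact: set_valP.
have squashP n (psi : {ptws E -> R}) : polar n psi ->
    exists k : K, forall x, Cp_fun (eval_Cp x) k = n.+1%:R^-1 * atan (psi x).
  move=> psiP; have kP : squashed (squash n psi).
      by right; exists n => //; exists psi.
  by exists (SigSub (mem_set kP)).
apply: (@embedding_embeds_in _ _ (eval_Cp : weak_space E -> Cp R K)).
- move=> x y xy; apply: sep => phi /continuous_polar[n phiP].
  have [k kP] := squashP _ _ phiP.
  apply: (can_inj (@atanK R)); apply: (@mulfI _ n.+1%:R^-1).
    by rewrite invr_eq0 pnatr_eq0.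
  by rewrite -!kP xy.
- move=> x.
  have FF : Filter (eval_Cp @ nbhs (x : weak_space E)) by exact: fmap_filter.
  refine ((@Cp_cvgP R K _ (eval_Cp x) FF).2 _) => k.
  suff Lk : (fun y => Cp_fun (eval_Cp y) k) @ nbhs (x : weak_space E)
      --> Cp_fun (eval_Cp x) k by exact: Lk.
  have := set_valP k => -[k0|[n _ [_ [phi -> phiU] kE]]].
    have E0 y : Cp_fun (eval_Cp y) k = 0.
      exact: (congr1 (fun f : E -> R => f y) k0).
    by rewrite (funext E0) E0; exact: cvg_cst.
  have E1 y : Cp_fun (eval_Cp y) k = n.+1%:R^-1 * atan (phi y).
    exact: esym (congr1 (fun f : E -> R => f y) kE).
  have L : phi @ nbhs (x : weak_space E) --> phi x.
    by apply: (weak_cvgP x _).1 => //; exact: polar_continuous phiU.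
  rewrite (funext E1) E1.
  apply: cvgMr; apply: continuous_cvg; first exact: continuous_atan.
  exact: L.
- move=> x A xA.
  pose W := initial_topology (eval_Cp : E -> Cp R K).
  suff Wx : nbhs (x : W) --> (x : weak_space E).
    by apply/nbhs_initialP; exact: Wx.
  apply/weak_cvgP => phi /continuous_polar[n phiP].
  have [k kP] := squashP _ _ phiP.
  have n0 : n.+1%:R != 0 :> R by rewrite pnatr_eq0.
  have phiE y : phi y = tan (n.+1%:R * Cp_fun (eval_Cp y) k).
    by rewrite kP mulrA divff// mul1r atanK.
  suff Lt : (fun y => tan (n.+1%:R * Cp_fun (eval_Cp y) k)) @ nbhs (x : W)
      --> tan (n.+1%:R * Cp_fun (eval_Cp x) k).
    by rewrite (funext phiE); exact: Lt.
  apply: (@continuous_cvg _ _ _ _ _ _ (fun r => tan r)).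
    apply: continuous_tan; rewrite kP mulrA divff// mul1r cos_atan.
    by rewrite invr_eq0 sqrtr_eq0 -ltNge ltr_pwDl// sqr_ge0.
  apply: cvgMr.
  have L := (initial_cvgP (eval_Cp : E -> Cp R K)
    (F := nbhs (x : W)) x _).1 (fun A => id).
  exact: (Cp_cvgP _ _).1 (L _) k.
Qed.

End polars.

Lemma Ck_metrizable_eberlein_grothendieck (R : realType) (X : topologicalType) :
  metrizable R (Ck R X) -> eberlein_grothendieck R (weak_space (Ck R X)).
Proof.
move=> /metrizableP[d dP].
apply: (@countable_base_eberlein_grothendieck R (Ck R X)
  (fun n => [set f | d 0 f < n.+1%:R^-1])).
- by move=> n; apply: (nbhs_dist dP); rewrite invr_gt0 ltr0n.
- move=> A /(nbhs_distP dP)[e e0 eA].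
  have [N _ /(_ N (leqnn N)) /= Ne] := near_infty_natSinv_lt (PosNum e0).
  by exists N => f /= fN; apply: eA; exact: lt_trans Ne.
- move=> f g fg; apply/continuousEP => x.
  have lin : linear ((fun h => Ck_fun h x) : Ck R X -> R^o) by [].
  pose phi : {linear Ck R X -> R^o} :=
    HB.pack ((fun h => Ck_fun h x) : Ck R X -> R^o)
    (GRing.isLinear.Build _ _ _ _ _ lin).
  apply: (fg phi) => h A /nbhs_ballP[e /= e0 eA].
  apply/Ck_nbhsP; exists [set x], e; split=> //; first exact: compact_set1.
  by move=> k hk; apply: eA; exact: hk.
Qed.

(** * Compactness in metric spaces *)

Section metric_compactness.
Context (R : realType) (X : topologicalType) (d : X -> X -> R).
Hypothesis dX : metrizes d.
Let dP := dX.1.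

(** Without a finite net there is an infinite sequence of points of A at mutual
    distances at least e, and such a sequence cannot cluster. *)
Lemma clustering_net (A : set X) (e : R) : 0 < e ->
  (forall u : nat -> X, (forall n, A (u n)) -> cluster (u @ \oo) !=set0) ->
  exists s : seq X, forall x, A x -> exists2 y, y \in s & d y x < e.
Proof.
move=> e0 Acl; apply: contrapT => /forallNP no.
have far (s : seq X) : exists x, A x /\ forall y, y \in s -> e <= d y x.
  have /existsNP[x /not_implyP[Ax xs]] := no s; exists x; split=> // y ys.
  by rewrite leNgt; apply/negP => yx; apply: xs; exists y.
have [pick pickP] := choice far.
(* l n lists the first n points of the sequence; the next one is pick (l n). *)
pose l := fix l n : seq X := if n is n.+1 then pick (l n) :: l n else [::].
have lmem i j : (i < j)%N -> pick (l i) \in l j.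
  elim: j => // j IH; rewrite ltnS leq_eqVlt => /predU1P[->|/IH] /=.
    exact: mem_head.
  by rewrite inE => ->; rewrite orbT.
have [z zcl] := Acl (fun n => pick (l n)) (fun n => (pickP (l n)).1).
have e20 : 0 < e / 2 by lra.
have near N : exists2 n, (N <= n)%N & d z (pick (l n)) < e / 2.
  have [|x [[n Nn <-] zx]] := zcl ((fun n => pick (l n)) @` [set n | (N <= n)%N])
    _ _ (nbhs_dist dX z e20); last by exists n.
  by exists N => // n Nn; exists n.
have [i _ zi] := near 0%N; have [j ij zj] := near i.+1.
have := (pickP (l j)).2 _ (lmem _ _ ij).
have := dist_tri dP z (pick (l i)) (pick (l j)).
rewrite (distS dP _ z); lra.
Qed.

Lemma ultra_seqU (F : set_system X) (I : eqType) (s : seq I) (B : I -> set X) :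
  UltraFilter F -> F [set x | exists2 i, i \in s & B i x] ->
  exists i, F (B i).
Proof.
move=> FU; have FF : ProperFilter F by exact: ultra_proper.
elim: s => [|i s IH] Fs.
  by have [x [? //]] := filter_ex Fs.
have [FBi|FnBi] := in_ultra_setVsetC (B i) FU; first by exists i.
apply: IH; apply: filterS2 Fs FnBi => x [j].
by rewrite inE => /predU1P[->//|js Bj] _; exists j.
Qed.

(** An ultrafilter on A contains balls of radius 1/(n+1) with centers c n, by
    total boundedness. Choosing u m in A and in the first m + 1 balls
    gives a sequence which clusters, and the ultrafilter converges to its
    cluster point. *)
Lemma clustering_compact (A : set X) : closed A ->
  (forall u : nat -> X, (forall n, A (u n)) -> cluster (u @ \oo) !=set0) ->
  compact A.
Proof.
move=> clA Acl; rewrite compact_ultra => F FU FA.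
have FF : ProperFilter F by exact: ultra_proper.
have n0 n : 0 < n.+1%:R^-1 :> R by rewrite invr_gt0 ltr0n.
have balls n : exists c, F [set x | d c x < n.+1%:R^-1].
  have [s sP] := clustering_net (n0 n) Acl.
  apply: (ultra_seqU (s := s) FU); apply: filterS FA => x /sP[y ys yx].
  by exists y.
have [c cP] := choice balls.
have pts m : exists x, A x /\ forall i : 'I_m.+1, d (c i) x < i.+1%:R^-1.
  have H : F [set x | forall i : 'I_m.+1, d (c i) x < i.+1%:R^-1].
    by apply: filter_forall => i; exact: cP.
  by have [x [Ax xP]] := filter_ex (filterI FA H); exists x.
have [u uP] := choice pts.
have [z zcl] := Acl u (fun n => (uP n).1).
have Fz : F --> z.
  move=> B /(nbhs_distP dX)[e e0 eB].
  have e30 : 0 < e / 3 by lra.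
  have [N _ /(_ N (leqnn N)) /= Ne] := near_infty_natSinv_lt (PosNum e30).
  have [|x [[m Nm <-] zx]] := zcl (u @` [set n | (N <= n)%N])
    _ _ (nbhs_dist dX z e30).
    by exists N => // n Nn; exists n.
  have Nm' : (N < m.+1)%N by rewrite ltnS.
  have /= Nu := (uP m).2 (Ordinal Nm').
  apply: filterS (cP N) => y /= Ny; apply: eB.
  have := dist_tri dP (u m) z y; have := dist_tri dP (c N) (u m) y.
  rewrite (distS dP (u m) (c N)); move: zx Nu Ny Ne => /=.
  set w : R := N.+1%:R^-1; lra.
exists z; split=> //; apply: clA => B zB.
exact: filter_ex (filterI FA (Fz B zB)).
Qed.

(** The near-covering property is used with the finite sets of points as
    parameters, directed by inclusion. *)
Lemma compact_net (C : set X) (e : R) : compact C -> 0 < e ->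
  exists s : seq X, forall x, C x -> exists2 y, y \in s & C y /\ d x y < e.
Proof.
move=> /compact_near_coveringP cC e0.
pose F := filter_from [set: seq X] (fun s => [set t : seq X | {subset s <= t}]).
have FF : ProperFilter F.
  apply: filter_from_proper; last by move=> s _; exists s.
  apply: filter_from_filter; first by exists [::].
  move=> s t _ _; exists (s ++ t) => // r str; split=> x xs; apply: str.
    by rewrite mem_cat xs.
  by rewrite mem_cat xs orbT.
suff : \forall s \near F, C `<=` [set x | exists2 y, y \in s & C y /\ d x y < e].
  by move=> H; have [s sP] := @filter_ex _ F FF _ H; exists s.
apply: cC => x Cx.
exists ([set y | d x y < e], [set s : seq X | x \in s]).
  split; first exact: nbhs_dist.
  by exists [:: x] => // s; apply; exact: mem_head.
by move=> [y s] [/= xy xs]; exists x => //; split=> //; rewrite (distS dP).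
Qed.

Lemma compact_dense_sequence (C : set X) (x0 : X) : compact C -> C x0 ->
  exists2 u : nat -> X, forall n, C (u n) &
    forall x e, C x -> 0 < e -> exists n, d x (u n) < e.
Proof.
move=> cC Cx0.
have n0 n : 0 < n.+1%:R^-1 :> R by rewrite invr_gt0 ltr0n.
have [s sP] := choice (fun n => compact_net cC (n0 n)).
pose v j := if (unpickle j : option (nat * nat)) is Some (n, k)
  then nth x0 (s n) k else x0.
pose u j := if v j \in C then v j else x0.
exists u => [j|x e Cx e0].
  by rewrite /u; case: ifPn => // /set_mem.
have [N _ /(_ N (leqnn N)) /= Ne] := near_infty_natSinv_lt (PosNum e0).
have [y ys [Cy xy]] := sP N x Cx.
exists (pickle (N, index y (s N))).
rewrite /u /v pickleK nth_index// (mem_set Cy).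
exact: lt_trans Ne.
Qed.

End metric_compactness.

(** * Continuous functionals on C_k *)

Section functionals.
Context (R : realType) (X : topologicalType).
Implicit Types (f g : Ck R X) (phi : {linear Ck R X -> R^o}).
Local Notation ev := (@Ck_fun R X).

Lemma Ck_funE f g a x : ev (a *: f + g) x = a * ev f x + ev g x.
Proof. by []. Qed.

Lemma compact_fun_bounded (C : set X) f : compact C ->
  exists M, forall x, C x -> `|ev f x| <= M.
Proof.
move=> cC.
have : compact (ev f @` C).
  apply: continuous_compact => //; apply: continuous_subspaceT; exact: cts_fun.
move=> /compact_bounded[M [_ HM]].
by exists (M + 1) => x Cx; apply: HM; [lra|exists x].
Qed.

(** A linear form that is bounded on the functions which are small on C is zero
    on those that vanish on C, as these can be rescaled at will. *)
Lemma functional_carrier phi : continuous phi ->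
  exists2 C, compact C &
    forall f g, (forall x, C x -> ev f x = ev g x) -> phi f = phi g.
Proof.
move=> cphi.
have B0 : nbhs (phi 0) (ball (0 : R) 1) by rewrite linear0; exact: nbhsx_ballx.
have : nbhs (0 : Ck R X) (phi @^-1` ball (0 : R) 1) := cphi 0 _ B0.
move=> /Ck_nbhsP[C [e [cC e0 CP]]]; exists C => // f g fg.
apply/eqP; rewrite -subr_eq0 -linearB; apply: contraT => fg0.
have /CP : forall x, C x -> `|ev 0 x - ev ((phi (f - g))^-1 *: (f - g)) x| < e.
  move=> x Cx; rewrite (_ : ev (_ *: _) x = (phi (f - g))^-1 * (ev f x - ev g x))//.
  by rewrite fg// subrr mulr0 subr0 normr0.
by rewrite /ball /= linearZ /= sub0r normrN /GRing.scale /= mulVf// normr1 ltxx.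
Qed.

Lemma half_series_le (n : nat) : \sum_(0 <= j < n) (2^-1 : R) ^+ j <= 2.
Proof.
suff -> : \sum_(0 <= j < n) (2^-1 : R) ^+ j = 2 - 2 * 2^-1 ^+ n.
  have : 0 <= (2^-1 : R) ^+ n by apply: exprn_ge0; rewrite invr_ge0.
  lra.
elim: n => [|n IH]; first by rewrite big_geq// expr0; lra.
rewrite big_nat_recr//= IH exprS; lra.
Qed.

Section dirac_series.
Variables (C : set X) (u : nat -> X).
Hypotheses (cC : compact C) (uC : forall n, C (u n)).

Let term f (j : nat) : R := 2^-1 ^+ j * ev f (u j).

Let half_ge0 j : 0 <= (2^-1 : R) ^+ j.
Proof. by apply: exprn_ge0; rewrite invr_ge0. Qed.

Let term_cvg f : cvgn (series (term f)).
Proof.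
have [M MP] := compact_fun_bounded f cC.
apply: normed_cvg; apply: (@series_le_cvg _ _ (geometric M 2^-1)) => [n|n|n|].
- exact: normr_ge0.
- rewrite /geometric /=; apply: mulr_ge0 => //.
  by apply: le_trans (MP _ (uC 0%N)); exact: normr_ge0.
- rewrite /geometric /term /= normrM ger0_norm// mulrC ler_wpM2r//.
  exact: MP.
- apply: is_cvg_geometric_series; rewrite ger0_norm; lra.
Qed.

(** Integration against an atomic measure that charges each u j: when u is dense
    in C, no point of C is outside its support. *)
Definition dirac_series f : R^o := limn (series (term f)).

Lemma dirac_series_linear : linear dirac_series.
Proof.
move=> a f g; apply: cvg_lim => //.
rewrite (_ : series _ = (fun n => a * series (term f) n + series (term g) n)).
  by apply: cvgD; [apply: cvgMr|]; exact: term_cvg.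
apply/funext => n; rewrite /series /= mulr_sumr -big_split /=.
by apply: eq_bigr => j _; rewrite /term Ck_funE; ring.
Qed.

Lemma dirac_series_bound f e : (forall x, C x -> `|ev f x| <= e) ->
  `|dirac_series f| <= 2 * e.
Proof.
move=> fe.
have L : (fun n => `|series (term f) n|) @ \oo --> `|dirac_series f|.
  by apply: cvg_norm; exact: term_cvg.
have c : closed [set r : R | r <= 2 * e] by exact: closed_le.
apply: (@closed_cvg _ _ \oo _ (fun n => `|series (term f) n|) _ c _ _ L).
apply: nearW => n; rewrite /= (le_trans (ler_norm_sum _ _ _))//.
have e0 : 0 <= e by apply: le_trans (fe _ (uC 0%N)).
apply: (@le_trans _ _ (\sum_(0 <= j < n) 2^-1 ^+ j * e)).
  apply: ler_sum => j _; rewrite /term normrM ger0_norm// ler_wpM2l//.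
  exact: fe.
by rewrite -mulr_suml ler_wpM2r// half_series_le.
Qed.

(** On nonnegative functions nothing cancels, so each point u j is felt by the
    functional. *)
Lemma dirac_series_ge f j : (forall x, 0 <= ev f x) ->
  2^-1 ^+ j * ev f (u j) <= dirac_series f.
Proof.
move=> f0; have t0 i : 0 <= term f i by apply: mulr_ge0.
have ndt : nondecreasing_seq (series (term f)).
  apply/nondecreasing_seqP => n; rewrite /series /= big_nat_recr//=.
  by rewrite lerDl.
apply: le_trans (nondecreasing_cvgn_le ndt (@term_cvg f) j.+1).
rewrite /series /= big_nat_recr//= lerDr.
exact: sumr_ge0.
Qed.

Lemma dirac_functional : exists2 phi : {linear Ck R X -> R^o}, continuous phi &
  forall f j, (forall x, 0 <= ev f x) -> 2^-1 ^+ j * ev f (u j) <= phi f.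
Proof.
pose phi : {linear Ck R X -> R^o} := HB.pack dirac_series
  (GRing.isLinear.Build _ _ _ _ dirac_series dirac_series_linear).
exists phi; last exact: dirac_series_ge.
move=> f A /nbhs_ballP[e /= e0 eA]; apply/Ck_nbhsP; exists C, (e / 4).
split=> // [|g fg]; first lra.
apply: eA; rewrite /ball /= -(@linearB _ _ _ _ phi).
apply: (@le_lt_trans _ _ (2 * (e / 4))); last lra.
by apply: dirac_series_bound => x Cx; apply: ltW; exact: fg.
Qed.

End dirac_series.
End functionals.

(** * A gliding hump *)

Section gliding_hump.
Context (R : realType) (X : topologicalType).
Local Notation ev := (@Ck_fun R X).

Lemma locally_finite_vanishing (f : nat -> Ck R X) (C : set X) :
  (forall y : X, \forall y' \near y & j \near \oo, ev (f j) y' = 0) -> compact C ->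
  exists N, forall j x, (N <= j)%N -> C x -> ev (f j) x = 0.
Proof.
move=> fin /compact_near_coveringP cC.
have [N _ NP] : \forall j \near \oo, C `<=` [set x | ev (f j) x = 0].
  by apply: cC => x _; exact: fin.
by exists N => j x Nj; exact: NP.
Qed.

(** The limit is continuous because it coincides near each point with a term of
    the sequence. *)
Lemma locally_stationary_limit (G : nat -> Ck R X) :
  (forall y : X, exists N, \forall y' \near y,
     forall i, (N <= i)%N -> ev (G i) y' = ev (G N) y') ->
  exists F : Ck R X, forall y, exists N, forall i, (N <= i)%N ->
    ev F y = ev (G i) y.
Proof.
move=> stab.
have [N NP] := choice stab.
pose F0 y := ev (G (N y)) y.
have F0E y y' : (forall i, (N y <= i)%N -> ev (G i) y' = ev (G (N y)) y') ->
    F0 y' = ev (G (N y)) y'.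
  move=> yy'; rewrite /F0 -(nbhs_singleton (NP y') (maxn (N y) (N y')))//.
    by apply: yy'; exact: leq_maxl.
  exact: leq_maxr.
have cF0 : continuous F0.
  move=> y; apply: (@cvg_trans _ (ev (G (N y)) @ y)).
    by apply: near_eq_cvg; apply: filterS (NP y) => y' /F0E.
  exact: cts_fun.
exists (mkcts cF0 : continuousType X R) => y; exists (N y) => i Ni.
by rewrite (nbhs_singleton (NP y)).
Qed.

Lemma dominating_term (a b c : R) : 0 <= a -> 2 + `|b| <= a * `|c| ->
  2 <= `|b + a * c|.
Proof.
move=> a0; rewrite -[X in X * _](ger0_norm a0) -normrM.
have := lerB_normD (a * c) b; rewrite (addrC b); lra.
Qed.

(** F is a sum of the a_i f_i over i >= N0, where f_i vanishes on C for these i.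
    The i-th coefficient is chosen so large that, for each j <= i, the term
    a_i phi_j(f_i), unless it is zero, exceeds by 2 what has been summed before.
    Since phi_j depends only on the values on a compact set, where
    almost all f_i vanish, the value phi_j F is determined by its last nonzero
    term; for j >= N0 there is one because phi_j(f_j) is nonzero. *)
Lemma gliding_hump (phi : nat -> {linear Ck R X -> R^o}) (f : nat -> Ck R X)
    (C : set X) :
  (forall j, continuous (phi j)) -> (forall j, phi j (f j) != 0) ->
  (forall y : X, \forall y' \near y & j \near \oo, ev (f j) y' = 0) ->
  compact C ->
  exists F : Ck R X, (forall x, C x -> ev F x = 0) /\
    exists N, forall j, (N <= j)%N -> 2 <= `|phi j F|.
Proof.
move=> cphi phif fin cC.
have [N0 N0P] := locally_finite_vanishing fin cC.
pose g j := if (j < N0)%N then 0 else f j.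
(* A sum over j, rather than a maximum, serves all j <= i at once; the terms
   with phi j (g i) = 0 vanish as division by zero gives zero. *)
pose coef (G : Ck R X) i :=
  \sum_(0 <= j < i.+1) (2 + `|phi j G|) / `|phi j (g i)|.
pose G := fix G i : Ck R X :=
  if i is i.+1 then G i + coef (G i) i *: g i else 0.
have GS i : G i.+1 = coef (G i) i *: g i + G i by rewrite addrC.
have coefP i j : (j <= i)%N -> phi j (g i) != 0 ->
    2 + `|phi j (G i)| <= coef (G i) i * `|phi j (g i)|.
  move=> ji gn0; rewrite -ler_pdivrMr ?normr_gt0//.
  rewrite /coef (bigD1_seq j) ?mem_index_iota ?iota_uniq//= ?lerDl.
  by apply: sumr_ge0 => k _; rewrite divr_ge0// addr_ge0.
have large i j : (N0 <= j)%N -> (j < i)%N -> 2 <= `|phi j (G i)|.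
  move=> Nj; elim: i => // i IH; rewrite ltnS => ji /=.
  rewrite linearD linearZ /= /GRing.scale /=.
  have [g0|gn0] := eqVneq (phi j (g i)) 0.
    rewrite g0 mulr0 addr0; apply: IH; rewrite ltn_neqAle ji andbT.
    apply/eqP => jiE; move: g0; rewrite /g -jiE ltnNge Nj /= => g0.
    by have := phif j; rewrite g0 eqxx.
  have c0 : 0 <= coef (G i) i.
    by apply: sumr_ge0 => k _; rewrite divr_ge0// addr_ge0.
  by apply: dominating_term => //; exact: coefP.
have gfin (y : X) : \forall y' \near y & j \near \oo, ev (g j) y' = 0.
  apply: filterS (fin y) => -[y' j] /=; rewrite /g; case: ifP => //.
have stab M (S : set X) : (forall j x, (M <= j)%N -> S x -> ev (g j) x = 0) ->
    forall i x, (M <= i)%N -> S x -> ev (G i) x = ev (G M) x.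
  move=> MS; elim=> [|i IH] x; first by rewrite leqn0 => /eqP ->.
  rewrite leq_eqVlt => /predU1P[->//|]; rewrite ltnS => Mi Sx.
  rewrite GS Ck_funE MS// mulr0 add0r; exact: IH.
have [F FP] : exists F : Ck R X, forall y, exists N, forall i, (N <= i)%N ->
    ev F y = ev (G i) y.
  apply: locally_stationary_limit => y; have [[U V] /= [yU [M _ MV]] UV] := gfin y.
  exists M; apply: filterS yU => y' Uy' i Mi.
  apply: (stab M [set y']) => // j x Mj ->; apply: (UV (y', j)).
  by split=> //; exact: MV.
have G0 i x : C x -> ev (G i) x = 0.
  move=> Cx; elim: i => [//|i IH].
  rewrite GS Ck_funE IH addr0 /g; case: ltnP => [_|Ni].
    by rewrite mulr0.
  by rewrite N0P// mulr0.
exists F; split=> [x Cx|]; first by have [N /(_ N (leqnn N)) ->] := FP x; exact: G0.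
exists N0 => j Nj; have [K cK KP] := functional_carrier (cphi j).
have [M MP] := locally_finite_vanishing gfin cK.
rewrite (KP F (G (maxn M j.+1))); first by apply: large => //; rewrite leq_maxr.
move=> x Kx; have [N NP] := FP x.
rewrite (NP (maxn N (maxn M j.+1))) ?leq_maxl//.
rewrite (stab _ _ MP) ?(stab _ _ MP (maxn M j.+1))// ?leq_maxl//.
by apply: leq_trans (leq_maxr _ _); rewrite leq_maxl.
Qed.

End gliding_hump.

(** * Exhausting X by the supports of functionals *)

(** In this section a f k stands for h f k - h 0 k, where h is an embedding of
    the weak topology into C_p(K). *)
Section exhaustion.
Context (R : realType) (X K : topologicalType) (d : X -> X -> R).
Hypothesis dX : metrizes d.
Hypothesis cK : compact [set: K].
Variable a : Ck R X -> K -> R.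
Hypothesis a_cont : forall f, continuous (a f).
Hypothesis a_nbhs : forall k e, 0 < e ->
  nbhs (0 : Ck R X) [set f | `|a f k| < e].
Hypothesis a_weak : forall phi : {linear Ck R X -> R^o}, continuous phi ->
  exists m (k : 'I_m -> K) n, forall f,
    (forall i, `|a f (k i)| < n.+1%:R^-1) -> `|phi f| <= 1.
Local Notation ev := (@Ck_fun R X).
Let dP := dX.1.

Definition controlled m n (phi : {linear Ck R X -> R^o}) (k : 'I_m -> K) :=
  continuous phi /\ forall f,
    (forall i, `|a f (k i)| < n.+1%:R^-1) -> `|phi f| <= 1.

(** Required for all r > 0, this says that x is in the support of phi. *)
Definition support_near (phi : {linear Ck R X -> R^o}) x r :=
  exists f : Ck R X, (forall y, r <= d x y -> ev f y = 0) /\ phi f != 0.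

(** As the functional may depend on r, this set is the closure of a union of
    supports. *)
Definition support_union m n : set X := [set x | forall r, 0 < r ->
  exists (phi : {linear Ck R X -> R^o}) (k : 'I_m -> K),
    controlled n phi k /\ support_near phi x r].

Lemma support_union_closed m n : closed (support_union m n).
Proof.
move=> x xcl r r0; have r20 : 0 < r / 2 by lra.
have [y [yS /= xy]] := xcl _ (nbhs_dist dX x r20).
have [phi [k [phik [f [f0 phif]]]]] := yS _ r20.
exists phi, k; split=> //; exists f; split=> // z xz; apply: f0.
have := dist_tri dP y x z; lra.
Qed.

(** The heart of the implication from the Eberlein-Grothendieck property to
    hemicompactness. If u has no cluster point, functions f j that vanish away
    from u j form a locally finite family, and the gliding hump contradicts the
    compactness of the m-th power of K. *)
Lemma support_union_clustering m n (u : nat -> X) :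
  (forall j, support_union m n (u j)) -> cluster (u @ \oo) !=set0.
Proof.
move=> uS; apply/set0P/eqP => ucl.
have n0 j : 0 < j.+1%:R^-1 :> R by rewrite invr_gt0 ltr0n.
have [phi phiP] := choice (fun j => uS j _ (n0 j)).
have [k kP] := choice phiP.
have [f fP] := choice (fun j => (kP j).2).
have fin (y : X) : \forall y' \near y & j \near \oo, ev (f j) y' = 0.
  have : ~ cluster (u @ \oo) y by rewrite ucl.
  move=> /existsNP[A /existsNP[B /not_implyP[uA /not_implyP[yB AB]]]].
  have {yB}[e e0 eB] := (nbhs_distP dX _ _).1 yB.
  have e20 : 0 < e / 2 by lra.
  exists ([set y' | d y y' < e / 2],
          [set j | A (u j) /\ j.+1%:R^-1 < e / 2]) => /=.
    split; first exact: nbhs_dist.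
    by apply: filterI => //; exact: near_infty_natSinv_lt (PosNum e20).
  move=> [y' j] [/= yy' [Auj je]]; apply: (fP j).1.
  have uje : e <= d y (u j).
    rewrite leNgt; apply/negP => ye; apply: AB.
    by exists (u j); split=> //; exact: eB.
  apply: (le_trans (ltW je)).
  have := dist_tri dP y' y (u j); rewrite (distS dP y' (u j)); lra.
have cKm : compact [set: {ptws 'I_m -> K}].
  have := @tychonoff 'I_m (fun=> K) (fun=> setT) (fun=> cK).
  by congr compact; apply/seteqP; split.
(* k0 is a cluster point of the tuples of points k j that control phi j. *)
have [k0 [_ k0cl]] := cKm ((k : nat -> {ptws 'I_m -> K}) @ \oo) _ filterT.
have : nbhs (0 : Ck R X) [set g | forall i, `|a g (k0 i)| < n.+1%:R^-1].
  exact: (@filter_forall (Ck R X) _ (fun i g => `|a g (k0 i)| < n.+1%:R^-1)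
    (nbhs (0 : Ck R X)) _ (fun i => a_nbhs (k0 i) (n0 n))).
move=> /Ck_nbhsP[C [e [cC e0 CP]]].
have [F [F0 [N FN]]] :=
  gliding_hump (fun j => (kP j).1.1) (fun j => (fP j).2) fin cC.
have Fk0 i : `|a F (k0 i)| < n.+1%:R^-1.
  by apply: (CP F) => x Cx; rewrite F0// subr0 normr0.
have : nbhs k0 [set l : {ptws 'I_m -> K} | forall i, `|a F (l i)| < n.+1%:R^-1].
  apply: (@filter_forall _ _ (fun i (l : {ptws 'I_m -> K}) =>
    `|a F (l i)| < n.+1%:R^-1) (nbhs k0)) => i.
  have FF : Filter (nbhs k0) by exact: nbhs_filter.
  have L : (fun l : {ptws 'I_m -> K} => a F (l i)) @ k0 --> a F (k0 i).
    have L0 := (@ptws_cvgP _ K (nbhs k0) k0 FF).1 (fun A => id) i.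
    exact: (cvg_comp _ _ L0 (@a_cont F (k0 i))).
  exact: (@cvgr_norm_lt R R^o _ (nbhs k0) FF _ _ L _ (Fk0 i)).
(* Some tuple k j with j >= N is so close to k0 that it controls phi j F. *)
move=> /(k0cl (k @` [set j | (N <= j)%N]))[|l [[j Nj <-] jF]].
  by exists N => // j Nj; exists j.
have := (kP j).1.2 F jF; have := FN j Nj; lra.
Qed.

Lemma support_union_compact m n : compact (support_union m n).
Proof.
apply: (clustering_compact dX); first exact: support_union_closed.
exact: support_union_clustering.
Qed.

Lemma bump_continuous x r : continuous (fun y => Num.max 0 (r - d x y)).
Proof.
move=> y; apply/cvgrPdist_lt => e e0; apply: filterS (nbhs_dist dX y e0) => z /= yz.
have := dist_tri dP y x z; have := dist_tri dP z x y; rewrite (distS dP z y).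
move: yz; rewrite ltr_norml !maxEle; do 2 case: ifP => ?; lra.
Qed.

Definition bump x r : Ck R X :=
  (mkcts (@bump_continuous x r) : continuousType X R).

(** Every point of C is in the support of the Dirac series of a sequence that is
    dense in C. *)
Lemma compact_sub_support_union (C : set X) : compact C ->
  exists m n, C `<=` support_union m n.
Proof.
move=> cC; have [->|/set0P[x0 Cx0]] := eqVneq C set0.
  by exists 0%N, 0%N.
have [u uC udense] := compact_dense_sequence dX cC Cx0.
have [phi cphi phiP] := dirac_functional R cC uC.
have [m [k [n kP]]] := a_weak cphi.
exists m, n => x Cx r r0; exists phi, k; split=> //.
have [j xj] := udense x r Cx r0.
have bE y : ev (bump x r) y = Num.max 0 (r - d x y) by [].
exists (bump x r); split=> [y ry|].
  by rewrite bE max_l//; lra.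
have b0 y : 0 <= ev (bump x r) y by rewrite bE le_max lexx.
rewrite gt_eqF//; apply: lt_le_trans (phiP _ j b0).
apply: mulr_gt0; first by apply: exprn_gt0; rewrite invr_gt0.
by rewrite bE lt_max subr_gt0 xj orbT.
Qed.

Lemma exhaustion_hemicompact : hemicompact X.
Proof.
exists (fun j => if (unpickle j : option (nat * nat)) is Some (m, n)
  then support_union m n else set0); split=> [j|C /compact_sub_support_union].
  by case: unpickle => [[m n]|]; [exact: support_union_compact|exact: compact0].
by move=> [m [n Cmn]]; exists (pickle (m, n)); rewrite pickleK.
Qed.

End exhaustion.

Lemma eberlein_grothendieck_hemicompact (R : realType) (X : topologicalType) :
  metrizable R X -> eberlein_grothendieck R (weak_space (Ck R X)) -> hemicompact X.
Proof.
move=> /metrizableP[d dX] [K [_ cK [S [f [g [fK gK cf cg]]]]]].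
pose h (z : Ck R X) : Cp R K := set_val (f z).
apply: (exhaustion_hemicompact dX cK
  (a := fun z k => Cp_fun (h z) k - Cp_fun (h 0) k)).
- move=> z k; apply: cvgB; first exact: (@cts_fun _ _ (h z : continuousType K R)).
  exact: (@cts_fun _ _ (h 0 : continuousType K R)).
- move=> k e e0.
  have FF : Filter (h @ nbhs (0 : Ck R X)) by exact: fmap_filter.
  have : h @ nbhs (0 : Ck R X) --> h 0.
    move=> A hA.
    have fA : nbhs (f 0) (set_val @^-1` A) by apply/nbhs_initialP; exists A.
    exact: (@nbhs_weak R (Ck R X) 0 _ (cf _ _ fA)).
  move=> /(Cp_cvgP _ FF)/(_ k)/cvgrPdist_lt/(_ e e0) H.
  by apply: (@filterS _ (nbhs (0 : Ck R X)) _ _ _ _ H) => z /=; rewrite distrC.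
- move=> phi cphi.
  have : nbhs (0 : weak_space (Ck R X)) [set z | `|phi z| < 1].
    have B0 : nbhs (phi 0) (ball (0 : R) 1) by rewrite linear0; exact: nbhsx_ballx.
    have H := (@weak_cvgP R (Ck R X) _ 0
      (@nbhs_filter _ (0 : weak_space (Ck R X)))).1 (fun A => id) phi cphi _ B0.
    apply: (@filterS _ (nbhs (0 : weak_space (Ck R X))) _ _ _ _ H) => z.
    by rewrite /ball /= sub0r normrN.
  rewrite -{1}(fK 0) => /cg/nbhs_initialP[B fB BP].
  have [m [k [n kP]]] := Cp_nbhs_finite fB.
  exists m, k, n => z zk; apply: ltW; rewrite -(fK z).
  by apply: BP; apply: kP.
Qed.

(** * The equivalence *)

Theorem theorem2p12 (R : realType) (X : topologicalType)
    (hX : metrizable R X) :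
  [<-> (* a *) hemicompact X;
       (* b *) compact [set: X] \/
         (exists (K : topologicalType) (p : K),
           [/\ metrizable R K, compact [set: K], ~ isolated [set: K] p
             & homeomorphic X (set_type [set~ p])]);
       (* c *) metrizable R (Ck R X);
       (* d *) eberlein_grothendieck R (weak_space (Ck R X))].
Proof.
tfae.
- move=> hemi; have [cX|ncX] := pselect (compact [set: X]); first by left.
  by right; exact: hemicompact_one_point.
- move=> b; apply: hemicompact_Ck_metrizable.
  case: b => [cX|[K [p [mK cK _ XKp]]]].
    by exists (fun=> setT); split=> // C _; exists 0%N.
  have [d dK] := (metrizableP R K).1 mK.
  apply: homeomorphic_hemicompact (homeomorphic_sym XKp) _.
  exact: punctured_hemicompact dK cK.
- exact: Ck_metrizable_eberlein_grothendieck.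
- exact: eberlein_grothendieck_hemicompact.
Qed.
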